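(* Let $A$ be a finite subset of $\mathbb{R}^n$. The following are equivalent: (i) $A$ is a spectral set; (ii) there exists a family $(U(t))_{t\in\mathbb{R}^n}$ of unitary operators on $L^2(A)$, continuous in $t$ and satisfying $U(t+s)=U(t)U(s)$ for all $t,s\in\mathbb{R}^n$, such that $U(a-a')\chi_a=\chi_{a'}$ for all $a,a'\in A$.
   Context: For $\lambda,x\in\mathbb{R}^n$ let $e_\lambda(x)=e^{2\pi i\lambda\cdot x}$. For a finite set $A\subset\mathbb{R}^n$ with $N=\#A$, let $\delta_A=\frac1N\sum_{a\in A}\delta_a$ be the normalized counting measure and $L^2(A):=L^2(\delta_A)$. $A$ is called spectral if there is $\Lambda\subset\mathbb{R}^n$ such that $\{e_\lambda|_A\}_{\lambda\in\Lambda}$ is an orthogonal basis of $L^2(A)$. For $a\in A$, $\chi_a$ is the function on $A$ equal to $1$ at $a$ and $0$ at the other points of $A$. *)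

(* Defs.v *)
From HB Require Import structures.
From mathcomp Require Import all_boot all_order all_algebra.
From mathcomp Require Import finmap.
From mathcomp Require Import complex.
From mathcomp Require Import all_classical all_reals all_analysis.

Set Implicit Arguments.
Unset Strict Implicit.
Unset Printing Implicit Defensive.

Import Order.TTheory GRing.Theory Num.Theory ComplexField.
Import numFieldNormedType.Exports.
Local Open Scope ring_scope.

Section Spectral.
Variables (R : realType) (n : nat).

Local Notation C := (complex R).

Definition dotR (x y : 'rV[R]_n) : R := \sum_(i < n) x ord0 i * y ord0 i.

Definition expi (theta : R) : C := (cos theta +i* sin theta)%C.

Definition e_ (lam x : 'rV[R]_n) : C := expi (2 * pi * dotR lam x).

Variable A : {fset 'rV[R]_n}.

Definition L2 := {ffun A -> C}.

(* inner product of L^2(delta_A), delta_A = normalized counting measure *)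
Definition l2dot (f g : L2) : C :=
  (#|` A|%:R)^-1 * \sum_(a : A) f a * (g a)^*.

Definition e_res (lam : 'rV[R]_n) : L2 := [ffun a : A => e_ lam (val a)].

Definition chi (a : A) : L2 := [ffun b : A => (b == a)%:R].

Definition orthogonal_basis_exp (Lam : set 'rV[R]_n) : Prop :=
  (forall lam, Lam lam -> e_res lam != 0) /\
  (forall lam mu, Lam lam -> Lam mu -> lam != mu ->
     l2dot (e_res lam) (e_res mu) = 0) /\
  (forall f : L2, exists (s : seq 'rV[R]_n) (c : 'rV[R]_n -> C),
     (forall lam, lam \in s -> Lam lam) /\
     f = \sum_(lam <- s) c lam *: e_res lam).

Definition spectral : Prop := exists Lam : set 'rV[R]_n, orthogonal_basis_exp Lam.

Definition unitary (U : L2 -> L2) : Prop :=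
  (forall (c : C) (f g : L2), U (c *: f + g) = c *: U f + U g) /\
  bijective U /\
  (forall f g, l2dot (U f) (U g) = l2dot f g).

End Spectral.

(* Main.v *)
Require Import Defs.
From HB Require Import structures.
From mathcomp Require Import all_boot all_order all_algebra.
From mathcomp Require Import finmap.
From mathcomp Require Import complex.
From mathcomp Require Import all_classical all_reals all_analysis.
From mathcomp Require Import ring lra.
Import Order.TTheory GRing.Theory Num.Theory ComplexField.
Import numFieldNormedType.Exports.
Local Open Scope ring_scope.

(** From a spectrum one gets U by letting U(t) multiply the coefficient of
    [e_lambda] by [e_lambda(t)].  Conversely, the operators U(t) commute, so every
    nonzero common invariant subspace contains a common eigenvector v, with
    U(t) v = chr(t) v.  The character chr is continuous and unimodular, hence of the
    form [e_lambda]; pairing v with the relation U(a - b) chi_a = chi_b then forces v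
    to be a multiple of [e_lambda] on A.  The frequencies arising in this way are
    pairwise orthogonal, and a maximal finite family of them spans, since
    otherwise its orthogonal complement, which is invariant, would provide one more. *)

Set Implicit Arguments.
Unset Strict Implicit.
Unset Printing Implicit Defensive.

(** * Complex-valued versus real-valued real and imaginary parts *)

Lemma Re_complexE (R : rcfType) (z : R[i]%C) : Re z = (complex.Re z)%:C%C.
Proof. by rewrite ReE ReJ_add. Qed.

Lemma Im_complexE (R : rcfType) (z : R[i]%C) : Im z = (complex.Im z)%:C%C.
Proof.
have ii : (@Num.imaginary R[i]%C) = (0 +i* 1)%C by reflexivity.
by rewrite ImE ImJ_sub ii [RHS]mulrC mulrA.
Qed.

Lemma ltc_dist_real (R : rcfType) (x y e : R) :
  (`|x%:C%C - y%:C%C| < e%:C%C) = (`|x - y| < e).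
Proof. by rewrite -rmorphB normc_def /= expr0n addr0 sqrtr_sqr ltcR. Qed.

Lemma gtc0_Re (R : rcfType) (e : R[i]%C) : 0 < e ->
  0 < complex.Re e /\ e = (complex.Re e)%:C%C.
Proof. by case: e => a b; rewrite ltcE /= => /andP[/eqP -> ->]. Qed.

(** Bridges the theorem, whose [Re] takes values in the complex field, to real analysis. A positive
    complex tolerance is a positive real, so the two epsilon conditions match. *)
Lemma continuous_Re (R : realType) (T : topologicalType) (F : T -> R[i]%C) :
  continuous (fun t => Re (F t)) <-> continuous (fun t => complex.Re (F t)).
Proof.
split=> cF x; apply/cvgrPdist_lt => e e0.
  have e0' : 0 < e%:C%C by rewrite ltcR.
  have /cvgrPdist_lt/(_ _ e0') := cF x.
  by apply: filterS => t; rewrite !Re_complexE ltc_dist_real.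
have [e0' eE] := gtc0_Re e0.
have /cvgrPdist_lt/(_ _ e0') := cF x.
by apply: filterS => t; rewrite !Re_complexE eE ltc_dist_real.
Qed.

Lemma continuous_Im (R : realType) (T : topologicalType) (F : T -> R[i]%C) :
  continuous (fun t => Im (F t)) <-> continuous (fun t => complex.Im (F t)).
Proof.
split=> cF x; apply/cvgrPdist_lt => e e0.
  have e0' : 0 < e%:C%C by rewrite ltcR.
  have /cvgrPdist_lt/(_ _ e0') := cF x.
  by apply: filterS => t; rewrite !Im_complexE ltc_dist_real.
have [e0' eE] := gtc0_Re e0.
have /cvgrPdist_lt/(_ _ e0') := cF x.
by apply: filterS => t; rewrite !Im_complexE eE ltc_dist_real.
Qed.

(** * Common eigenvectors of commuting matrices *)

(* On a stable subspace of minimal positive rank every [F t] acts as a scalar. *)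
Lemma common_eigenvector_family (C : numClosedFieldType) (T : Type) m n
    (F : T -> 'M[C]_n) (V : 'M[C]_(m, n)) :
  (forall s t, comm_mx (F s) (F t)) -> (forall t, stablemx V (F t)) -> V != 0 ->
  exists v : 'rV[C]_n, [/\ v != 0, (v <= V)%MS & forall t, exists a, v *m F t = a *: v].
Proof.
move=> comF stV V0.
pose P k := `[< exists W : 'M[C]_n,
  [/\ W != 0, (W <= V)%MS, forall t, stablemx W (F t) & \rank W = k] >].
have exP : exists k, P k.
  exists (\rank V); apply/asboolP; exists (<<V>>%MS).
  (* [V] need not be square, so its square generator [<<V>>] stands for the same row space. *)
  split=> [|||//]; rewrite ?genmxE //; first by rewrite -mxrank_eq0 genmxE mxrank_eq0.
  by move=> t; rewrite (eqmx_stable _ (genmxE V)).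
have [_ /asboolP[W [W0 WV stW <-]] minW] := ex_minnP exP.
exists (nz_row W); split; first by rewrite nz_row_eq0.
  exact: submx_trans (nz_row_sub W) WV.
move=> t.
have rW : (0 < \rank W)%N by rewrite lt0n mxrank_eq0.
have [a /eigenvalueP[u /eigenspaceP ua u0]] :=
  eigenvalue_closed (restrictmx W (F t)) rW.
exists a; apply/eigenspaceP; apply: submx_trans (nz_row_sub W) _.
rewrite sub_eigenspace_conjmx ?stablemx_row_base ?row_base_free // in ua.
(* The part of the eigenspace inside [W] is nonzero, since it contains the lift of [u], and stable
   by commutation. Minimality of the rank makes it all of [W]. *)
pose E := (W :&: eigenspace (F t) a)%MS.
have EW : (E <= W)%MS by exact: capmxSl.
have : P (\rank E).
  apply/asboolP; exists E; split => //.
  - apply: contraNneq u0 => E0.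
    rewrite -(mulmx_free_eq0 u (row_base_free W)) -submx0 -E0 sub_capmx ua.
    by rewrite (submx_trans (submxMl _ _)) ?eq_row_base.
  - exact: submx_trans EW WV.
  - move=> s; rewrite sub_capmx; apply/andP; split.
      exact: submx_trans (submxMr _ EW) (stW s).
    apply: submx_trans (submxMr _ (capmxSr _ _)) _.
    by rewrite comm_mx_stable_eigenspace.
move=> /minW rk; apply: submx_trans (capmxSr W _).
by rewrite -/E -(geq_leqif (mxrank_leqif_sup EW)).
Qed.

(** * Continuous unimodular characters of the real line *)

Lemma continuous_dyadic_cst (R : realType) (h : R -> R) (d c : R) :
  0 < d -> continuous h -> (forall (m : int) k, h (m%:~R * (d / 2 ^+ k)) = c) ->
  forall t, h t = c.
Proof.
move=> d0 ch hc t.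
pose v (k : nat) : R := d / 2 ^+ k.
have v0 k : 0 < v k by rewrite divr_gt0 ?exprn_gt0.
(* The largest multiple of [v k] not exceeding [t]. It lies between [t - v k] and [t], so these
   dyadic points converge to [t]. *)
pose u (k : nat) : R := (Num.floor (t / v k))%:~R * v k.
have vE : v = geometric d 2^-1 by apply/funext => k; rewrite /v /= exprVn.
have cv : (v k @[k --> \oo] --> (0 : R))%classic.
  by rewrite vE; apply: cvg_geometric; rewrite ger0_norm ?invr_ge0 // invf_lt1 ?ltr1n.
have cu : (u k @[k --> \oo] --> t)%classic.
  apply: (@squeeze_cvgr _ _ _ _ (fun k => t - v k) (fun=> t)); last exact: cvg_cst.
    near=> k.
    have := floor_itv (t / v k); rewrite intrD ler_pdivlMr // ltr_pdivrMr // /u.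
    by rewrite mulrDl mul1r => /andP[-> /ltW]; rewrite andbT lerBlDr.
  by rewrite -[X in (_ --> X)%classic]subr0; apply: cvgB => //; apply: cvg_cst.
have chu : (h (u k) @[k --> \oo] --> h t)%classic.
  by apply: continuous_cvg => //; exact: ch.
apply/esym; apply: (cvg_unique _ _ chu) => //.
have -> : (fun k => h (u k)) = fun=> c by apply/funext => k; exact: hc.
exact: cvg_cst.
Unshelve. all: by end_near.
Qed.

Section Expi.
Variable R : realType.
Implicit Types s t : R.

Lemma expi0 : expi 0 = 1 :> R[i]%C.
Proof. by rewrite /expi cos0 sin0. Qed.

Lemma expiD s t : expi (s + t) = expi s * expi t.
Proof.
by rewrite /expi cosD sinD; apply/eqP; rewrite eq_complex /= eqxx addrC [sin s * _]mulrC eqxx.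
Qed.

Lemma expi_conj t : (expi t)^* = expi (- t).
Proof. by rewrite /expi cosN sinN. Qed.

Lemma expiN t : expi (- t) * expi t = 1.
Proof. by rewrite -expiD addNr expi0. Qed.

Lemma expi_neq0 t : expi t != 0.
Proof. by apply/eqP => t0; have := expiN t; rewrite t0 mulr0 => /esym/eqP; rewrite oner_eq0. Qed.

Lemma expiM_conj t : expi t * (expi t)^* = 1.
Proof. by rewrite expi_conj mulrC expiN. Qed.

(** With positive real part, the angle is the arcsine of the imaginary part: the cosine of that
    arcsine is the nonnegative root, which is then the real part itself. *)
Lemma expi_arg (z : R[i]%C) : z * z^* = 1 -> 0 < complex.Re z ->
  exists2 th, `|th| <= pi / 2 & z = expi th.
Proof.
case: z => a b /= /(congr1 (@complex.Re R)) /= ; rewrite mulrN opprK => ab a0.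
have b1 : -1 <= b <= 1 by apply/andP; split; nra.
exists (asin b); first by rewrite ler_norml asin_geNpi2 ?asin_lepi2.
rewrite /expi asinK // cos_asin //; congr (_ +i* _)%C.
have -> : 1 - b ^+ 2 = a ^+ 2 by rewrite -ab; ring.
by rewrite sqrtr_sqr gtr0_norm.
Qed.

(* Of the two square roots of [f (d / 2 ^+ k)], positivity of the real part selects
   the one continuing the branch [expi (th / 2 ^+ k)]. *)
Lemma character_dyadic (f : R -> R[i]%C) (d th : R) k :
  (forall s t, f (s + t) = f s * f t) ->
  (forall t, `|t| <= d -> 0 < complex.Re (f t)) -> 0 < d -> `|th| <= pi / 2 ->
  f d = expi th -> f (d / 2 ^+ k) = expi (th / 2 ^+ k).
Proof.
move=> fD fpos d0 thpi fd; elim: k => [|k IH]; first by rewrite expr0 !divr1.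
set z := f _; set w := expi _.
have half x : x / 2 ^+ k = x / 2 ^+ k.+1 + x / 2 ^+ k.+1 :> R.
  by rewrite exprS; field; rewrite expf_neq0.
have zw : z ^+ 2 = w ^+ 2.
  by rewrite !expr2 -fD -expiD -!half.
have p2 : 1 < 2 ^+ k.+1 :> R by rewrite exprn_egt1 ?ltr1n.
have p0 : 0 < 2 ^+ k.+1 :> R by rewrite exprn_gt0.
have z0 : 0 < complex.Re z.
  apply: fpos; rewrite normrM normfV !gtr0_norm // ler_pdivrMr // ler_peMr // ltW //.
(* At least one halving has taken place, so the angle is strictly below [pi / 2] in absolute value
   and its cosine is positive. *)
have w0 : 0 < complex.Re w.
  apply: cos_gt0_pihalf; rewrite -ltr_norml normrM normfV (gtr0_norm p0).
  rewrite ltr_pdivrMr // (le_lt_trans thpi) // ltr_pMr // divr_gt0 // pi_gt0 //.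
move: zw => /eqP; rewrite eqf_sqr => /orP[/eqP //|/eqP zw].
by move: z0; rewrite zw; case: (w) w0 => a b /= a0; rewrite oppr_gt0 => /(lt_trans a0); rewrite ltxx.
Qed.

(** An angle for [f d] at one small [d] determines the frequency. The quotient [g] of [f] by the
    candidate exponential is 1 at all dyadic multiples of [d], hence everywhere by density. *)
Lemma continuous_character (f : R -> R[i]%C) :
  (forall s t, f (s + t) = f s * f t) -> (forall t, f t * (f t)^* = 1) ->
  continuous (fun t => complex.Re (f t)) -> continuous (fun t => complex.Im (f t)) ->
  exists k, forall t, f t = expi (k * t).
Proof.
move=> fD f1 cRe cIm.
have f0 : f 0 = 1.
  have fn0 : f 0 != 0.
    by apply/eqP => f00; have := f1 0; rewrite f00 mul0r => /esym/eqP; rewrite oner_eq0.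
  by apply: (mulfI fn0); rewrite -fD addr0 mulr1.
(* Since [f 0 = 1], near 0 the real part stays within distance 1 of 1. Halving the radius allows the
   closed bound on [t]. *)
have [d d0 fpos] : exists2 d : R, 0 < d & forall t, `|t| <= d -> 0 < complex.Re (f t).
  have /cvgrPdist_lt/(_ _ ltr01) := cRe 0; rewrite f0 /= => -[e /= e0 He].
  exists (e / 2); first by rewrite divr_gt0.
  move=> t te; have := He t; rewrite /= sub0r normrN => /(_ (le_lt_trans te _)).
  have e2 : e / 2 < e by lra.
  by rewrite ltr_norml => /(_ e2)/andP[]; lra.
have [|th thpi fd] := expi_arg (f1 d); first by rewrite fpos ?gtr0_norm.
exists (th / d).
pose g t := f t * expi (- (th / d * t)).
have gD s t : g (s + t) = g s * g t.
  by rewrite /g fD mulrDr opprD expiD mulrACA.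
have g0 : g 0 = 1 by rewrite /g f0 mulr0 oppr0 expi0 mulr1.
have gdy (m : int) k : g (m%:~R * (d / 2 ^+ k)) = 1.
  have g1 : g (d / 2 ^+ k) = 1.
    rewrite /g (character_dyadic k fD fpos d0 thpi fd).
    by rewrite -expiD (_ : _ + _ = 0) ?expi0 //; field; rewrite expf_neq0 // gt_eqF.
  have gn (n : nat) : g (n%:R * (d / 2 ^+ k)) = 1.
    by elim: n => [|n IH]; rewrite ?mul0r // -natr1 mulrDl mul1r gD IH g1 mulr1.
  case: m => n; first exact: gn.
  rewrite NegzE mulrNz mulNr; set x := _ * _.
  by rewrite -[LHS]mulr1 -[X in _ * X](gn n.+1) -gD addNr.
have clin : continuous (fun t => th / d * t) by move=> t; apply: cvgM; [exact: cvg_cst|exact: cvg_id].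
have ccos : continuous (fun t => cos (th / d * t)).
  by move=> t; apply: continuous_comp; [exact: clin|exact: continuous_cos].
have csin : continuous (fun t => sin (th / d * t)).
  by move=> t; apply: continuous_comp; [exact: clin|exact: continuous_sin].
(* The real and imaginary parts of [g] written out, so that the density argument applies to
   real-valued functions. *)
pose gr t := complex.Re (f t) * cos (th / d * t) + complex.Im (f t) * sin (th / d * t).
pose gi t := complex.Im (f t) * cos (th / d * t) - complex.Re (f t) * sin (th / d * t).
have gE t : g t = (gr t +i* gi t)%C.
  rewrite /g /gr /gi /expi cosN sinN; case: (f t) => a b.
  by apply/eqP; rewrite eq_complex /= !mulrN opprK eqxx addrC eqxx.
have gdyE m k := etrans (esym (gE (m%:~R * (d / 2 ^+ k)))) (gdy m k).
have cgr : continuous gr.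
  by move=> x; apply: cvgD; apply: cvgM; [exact: cRe|exact: ccos|exact: cIm|exact: csin].
have cgi : continuous gi.
  by move=> x; apply: cvgB; apply: cvgM; [exact: cIm|exact: ccos|exact: cRe|exact: csin].
have g1 t : g t = 1.
  rewrite gE (continuous_dyadic_cst d0 cgr (c := 1)) => [|m k]; last by case: (gdyE m k).
  by rewrite (continuous_dyadic_cst d0 cgi (c := 0)) // => m k; case: (gdyE m k).
move=> t; apply: (mulIf (expi_neq0 (- (th / d * t)))).
by rewrite -/(g t) g1 mulrC expiN.
Qed.

End Expi.

(** * Exponentials and continuous characters on the row space *)

Section Exponentials.
Variables (R : realType) (n : nat).
Implicit Types (x y l m t : 'rV[R]_n).

Lemma dotRC x y : dotR x y = dotR y x.
Proof. by apply: eq_bigr => i _; rewrite mulrC. Qed.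

Lemma dotRDr x y t : dotR x (y + t) = dotR x y + dotR x t.
Proof. by rewrite -big_split; apply: eq_bigr => i _; rewrite mxE mulrDr. Qed.

Lemma dotRNr x y : dotR x (- y) = - dotR x y.
Proof. by rewrite -sumrN; apply: eq_bigr => i _; rewrite mxE mulrN. Qed.

Lemma dotRZr a x y : dotR x (a *: y) = a * dotR x y.
Proof. by rewrite mulr_sumr; apply: eq_bigr => i _; rewrite mxE mulrCA. Qed.

Lemma dotR_neq0 x : x != 0 -> dotR x x != 0.
Proof.
apply: contraNneq => /eqP; rewrite psumr_eq0 => [/allP xx|i _]; last first.
  by rewrite -expr2 sqr_ge0.
apply/eqP/rowP => i; rewrite mxE; have := xx i (mem_index_enum _).
by rewrite /= mulf_eq0 orbb => /eqP.
Qed.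

Lemma e_D l x y : e_ l (x + y) = e_ l x * e_ l y.
Proof. by rewrite /e_ dotRDr mulrDr expiD. Qed.

Lemma e_N l x : e_ l (- x) = (e_ l x)^*.
Proof. by rewrite /e_ dotRNr mulrN expi_conj. Qed.

Lemma e_mul_conj l x : e_ l x * (e_ l x)^* = 1.
Proof. exact: expiM_conj. Qed.

Lemma e_neq0 l x : e_ l x != 0.
Proof. exact: expi_neq0. Qed.

Lemma e_separates l m : l != m -> exists t, e_ l t * (e_ m t)^* != 1.
Proof.
rewrite -subr_eq0 => lm; set d := l - m in lm.
(* Chosen so that [d] pairs with it to 1/2: the quotient of the two exponentials is then [expi pi],
   that is -1. *)
exists ((2 * dotR d d)^-1 *: d).
rewrite /e_ expi_conj -expiD -mulrBr -!(dotRC ((2 * _)^-1 *: d)) -dotRNr -dotRDr -/d.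
have -> : 2 * pi * dotR ((2 * dotR d d)^-1 *: d) d = pi.
  by rewrite dotRC dotRZr; field; rewrite dotR_neq0.
rewrite /expi cospi sinpi eq_complex /= eqxx andbT.
by rewrite -subr_eq0 -opprD oppr_eq0 -mulr2n pnatr_eq0.
Qed.

Lemma continuous_e l : continuous (fun t => complex.Re (e_ l t)) /\
  continuous (fun t => complex.Im (e_ l t)).
Proof.
have cdot : continuous (dotR l).
  apply: (@continuous_big R _ +%R 0 xpredT (@add_continuous R) 'rV[R]_n) => i _ x.
  by apply: continuousM; [exact: cst_continuous|exact: coord_continuous].
have cd : continuous (fun t => 2 * pi * dotR l t).
  by move=> t; apply: (continuous_comp (cdot t)); exact: mulrl_continuous.
split=> t; apply: continuous_comp; [exact: cd|exact: continuous_cos|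
                                    exact: cd|exact: continuous_sin].
Qed.

(** The one-variable result on each coordinate axis gives a slope [k i]. Multiplicativity
    reassembles [f], and dividing by [2 * pi] matches the normalization of [e_]. *)
Lemma continuous_character_rV (f : 'rV[R]_n -> R[i]%C) :
  (forall s t, f (s + t) = f s * f t) -> (forall t, f t * (f t)^* = 1) ->
  continuous (fun t => complex.Re (f t)) -> continuous (fun t => complex.Im (f t)) ->
  exists l, forall t, f t = e_ l t.
Proof.
move=> fD f1 cRe cIm.
have cdelta i : continuous (fun s : R => s *: (delta_mx ord0 i : 'rV[R]_n)).
  exact: scalel_continuous.
have /choice[k kE] : forall i : 'I_n, exists k : R,
    forall s, f (s *: delta_mx ord0 i) = expi (k * s).
  move=> i; apply: continuous_character => [s t|t||].
  - by rewrite scalerDl fD.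
  - exact: f1.
  - by move=> s; exact: (continuous_comp (cdelta i s) (cRe _)).
  - by move=> s; exact: (continuous_comp (cdelta i s) (cIm _)).
have f0 : f 0 = 1.
  have fn0 : f 0 != 0.
    by apply/eqP => f00; have := f1 0; rewrite f00 mul0r => /esym/eqP; rewrite oner_eq0.
  by apply: (mulfI fn0); rewrite -fD addr0 mulr1.
exists (\row_i (k i / (2 * pi))) => t.
rewrite {1}[t]row_sum_delta (big_morph f fD f0) /e_ mulr_sumr.
rewrite (big_morph (@expi R) (@expiD R) (@expi0 R)).
have := lt0r_neq0 (pi_gt0 R); move: (pi : R) => p p0.
by apply: eq_bigr => i _; rewrite kE mxE; congr expi; field.
Qed.

End Exponentials.

(** * Inner product, orthonormal exponentials and multipliers *)

Section L2Theory.
Variables (R : realType) (n : nat) (A : {fset 'rV[R]_n}).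
Local Notation C := R[i]%C.
Implicit Types (f g h : L2 A) (l m : 'rV[R]_n) (E : seq 'rV[R]_n).

Lemma l2dotDl f g h : l2dot (f + g) h = l2dot f h + l2dot g h.
Proof.
rewrite -mulrDr -big_split; congr (_ * _).
by apply: eq_bigr => a _; rewrite ffunE mulrDl.
Qed.

Lemma l2dotZl (c : C) f g : l2dot (c *: f) g = c * l2dot f g.
Proof.
rewrite mulrCA mulr_sumr; congr (_ * _).
by apply: eq_bigr => a _; rewrite ffunE -mulrA.
Qed.

Lemma l2dotC f g : l2dot g f = (l2dot f g)^*.
Proof.
rewrite rmorphM fmorphV rmorph_nat rmorph_sum; congr (_ * _).
by apply: eq_bigr => a _; rewrite rmorphM /= conjCK mulrC.
Qed.

Lemma l2dot0l g : l2dot 0 g = 0.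
Proof. by rewrite -(scale0r 0) l2dotZl mul0r. Qed.

Lemma l2dot_suml (I : eqType) (s : seq I) (F : I -> L2 A) g :
  l2dot (\sum_(i <- s) F i) g = \sum_(i <- s) l2dot (F i) g.
Proof. exact: (big_morph (fun f => l2dot f g) (fun f h => l2dotDl f h g) (l2dot0l g)). Qed.

Lemma l2dotZr (c : C) f g : l2dot f (c *: g) = c^* * l2dot f g.
Proof. by rewrite l2dotC l2dotZl rmorphM /= -l2dotC. Qed.

Lemma l2dot_sumr (I : eqType) (s : seq I) (F : I -> L2 A) f :
  l2dot f (\sum_(i <- s) F i) = \sum_(i <- s) l2dot f (F i).
Proof.
by rewrite l2dotC l2dot_suml rmorph_sum; apply: eq_bigr => i _; rewrite /= -l2dotC.
Qed.

Lemma card_neq0 (a : A) : (#|` A|%:R : C) != 0.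
Proof. by rewrite pnatr_eq0 cardfE -lt0n; apply/card_gt0P; exists a. Qed.

Lemma L2_neq0 f : f != 0 -> exists a, f a != 0.
Proof.
move=> f0; apply/existsP; apply: contraNT f0; rewrite negb_exists => /forallP f0.
by apply/eqP/ffunP => a; rewrite ffunE; apply/eqP; have := f0 a; rewrite negbK.
Qed.

Lemma l2dot_neq0 f : f != 0 -> l2dot f f != 0.
Proof.
move=> /L2_neq0[a fa0]; apply: mulf_neq0; first by rewrite invr_eq0 card_neq0.
rewrite psumr_eq0 => [|b _]; last exact: mul_conjC_ge0.
by apply: contra fa0 => /allP/(_ a (mem_index_enum _)); rewrite /= mul_conjC_eq0.
Qed.

Lemma l2dot_chi f (a : A) : l2dot f (chi a) = (#|` A|%:R)^-1 * f a.
Proof.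
congr (_ * _); rewrite (bigD1 a) //= ffunE eqxx conjC1 mulr1 big1 ?addr0 // => b ba.
by rewrite ffunE (negPf ba) conjC0 mulr0.
Qed.

Lemma l2dot_chi_e_res l (a : A) :
  l2dot (chi a) (e_res A l) = (#|` A|%:R)^-1 * (e_ l (val a))^*.
Proof. by rewrite l2dotC l2dot_chi ffunE rmorphM fmorphV rmorph_nat. Qed.

Lemma L2_chi f : f = \sum_(a : A) f a *: chi a.
Proof.
apply/ffunP => b; rewrite sum_ffunE (bigD1 b) //= big1 => [|a ab].
  by rewrite !ffunE eqxx addr0 -[LHS]mulr1.
by rewrite !ffunE eq_sym (negPf ab) -[LHS]/(_ * _) mulr0.
Qed.

(** Exponentials are unimodular and the measure is normalized. A nonzero restriction supplies a
    point of [A], so the division by the cardinality is legitimate. *)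
Lemma e_res_norm l : e_res A l != 0 -> l2dot (e_res A l) (e_res A l) = 1.
Proof.
move=> /L2_neq0[a _]; rewrite /l2dot (eq_bigr (fun=> 1)) => [|b _].
  by rewrite sumr_const cardfE mulVf // -cardfE (card_neq0 a).
by rewrite !ffunE e_mul_conj.
Qed.

(** For orthonormal [E], this is the operator that is diagonal on the span of [E] with eigenvalues
    [c] and zero on the orthogonal complement; [c = 1] gives the orthogonal projection. *)
Definition multiplier E (c : 'rV[R]_n -> C) f : L2 A :=
  \sum_(l <- E) (c l * l2dot f (e_res A l)) *: e_res A l.

Definition orthonormal_exp E := uniq E /\
  {in E &, forall l m, l2dot (e_res A l) (e_res A m) = (l == m)%:R}.

Lemma multiplier_linear E c : linear (multiplier E c).
Proof.
move=> a f g; rewrite scaler_sumr -big_split; apply: eq_bigr => l _ /=.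
by rewrite l2dotDl l2dotZl mulrDr scalerDl scalerA mulrCA.
Qed.

Lemma eq_multiplier E c d : c =1 d -> multiplier E c =1 multiplier E d.
Proof. by move=> cd f; apply: eq_bigr => l _; rewrite cd. Qed.

Section Orthonormal.
Variables (E : seq 'rV[R]_n) (orthoE : orthonormal_exp E).

Lemma l2dot_multiplier c f l : l \in E ->
  l2dot (multiplier E c f) (e_res A l) = c l * l2dot f (e_res A l).
Proof.
have [uE oE] := orthoE => lE; rewrite l2dot_suml (bigD1_seq l) //= big_seq_cond big1.
  by rewrite addr0 l2dotZl oE // eqxx mulr1.
by move=> m /andP[mE ml]; rewrite l2dotZl oE // (negPf ml) mulr0.
Qed.

Lemma multiplierM c d f :
  multiplier E c (multiplier E d f) = multiplier E (fun l => c l * d l) f.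
Proof.
by apply: eq_big_seq => l lE; rewrite l2dot_multiplier // mulrA.
Qed.

Lemma multiplier_e_res c l : l \in E -> multiplier E c (e_res A l) = c l *: e_res A l.
Proof.
have [uE oE] := orthoE => lE; rewrite /multiplier (bigD1_seq l) //= big_seq_cond big1.
  by rewrite addr0 oE // eqxx mulr1.
by move=> m /andP[mE ml]; rewrite oE // eq_sym (negPf ml) mulr0 scale0r.
Qed.

(** Parseval on the span of [E]: each term picks up the factor [c l * (c l)^*]. The projections
    appear because [f] and [g] need not lie in that span. *)
Lemma l2dot_multiplier2 c f g : (forall l, c l * (c l)^* = 1) ->
  l2dot (multiplier E c f) (multiplier E c g) =
  l2dot (multiplier E (fun=> 1) f) (multiplier E (fun=> 1) g).
Proof.
move=> c1; rewrite {2 4}/multiplier !l2dot_sumr; apply: eq_big_seq => l lE.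
rewrite !l2dotZr !l2dot_multiplier // !mul1r rmorphM /=.
by rewrite mulrACA [_^* * c l]mulrC c1 mul1r.
Qed.

(* The matrix of the family has a right inverse, its rescaled adjoint. *)
Lemma orthonormal_size : (size E <= #|{: A}|)%N.
Proof.
have [uE oE] := orthoE.
pose e (i : 'I_(size E)) := e_res A (tnth (in_tuple E) i).
pose G := \matrix_(i < size E, j < #|{: A}|) (e i (enum_val j)).
pose H := \matrix_(j < #|{: A}|, i < size E) ((#|` A|%:R)^-1 * (e i (enum_val j))^* : C).
apply: (@mulmx1_min C _ _ G H); apply/matrixP => i k; rewrite !mxE.
have -> : (i == k) = (tnth (in_tuple E) i == tnth (in_tuple E) k).
  by rewrite !(tnth_nth 0) nth_uniq.
rewrite -oE ?mem_tnth // /l2dot mulr_sumr [RHS](reindex_onto enum_val enum_rank) /=; last first.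
  by move=> a _; rewrite enum_rankK.
apply: eq_big => [j|j _]; first by rewrite enum_valK eqxx.
by rewrite !mxE mulrCA.
Qed.

End Orthonormal.
End L2Theory.

(** * Passage from operators to matrices *)

Section MatrixOf.
Variables (R : realType) (n : nat) (A : {fset 'rV[R]_n}).
Local Notation C := R[i]%C.
Local Notation N := #|{: A}|.
Implicit Types (f g : L2 A) (L K : L2 A -> L2 A).

Lemma linear_fun_sum L (I : Type) (s : seq I) (c : I -> C) (F : I -> L2 A) : linear L ->
  L (\sum_(i <- s) c i *: F i) = \sum_(i <- s) c i *: L (F i).
Proof.
move=> linL; have L0 : L 0 = 0.
  by have := linL (-1) 0 0; rewrite scaler0 addr0 scaleN1r addNr.
by elim: s => [|i s IH]; rewrite ?big_nil // !big_cons linL IH.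
Qed.

Lemma linear_funZ L (c : C) f : linear L -> L (c *: f) = c *: L f.
Proof.
by move=> linL; have := linear_fun_sum [:: tt] (fun=> c) (fun=> f) linL; rewrite !big_seq1.
Qed.

Definition rV_of f : 'rV[C]_N := \row_i f (enum_val i).

Definition ffun_of (v : 'rV[C]_N) : L2 A := [ffun a => v ord0 (enum_rank a)].

Definition mx_of L : 'M[C]_N := \matrix_i rV_of (L (chi (enum_val i))).

Lemma rV_ofK : cancel rV_of ffun_of.
Proof. by move=> f; apply/ffunP => a; rewrite ffunE mxE enum_rankK. Qed.

Lemma ffun_ofK : cancel ffun_of rV_of.
Proof. by move=> v; apply/rowP => i; rewrite mxE ffunE enum_valK. Qed.

Lemma rV_of0 : rV_of 0 = 0.
Proof. by apply/rowP => i; rewrite !mxE ffunE. Qed.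

Lemma mul_mx_of L f : linear L -> rV_of f *m mx_of L = rV_of (L f).
Proof.
move=> linL; apply/rowP => j; rewrite !mxE {2}[f]L2_chi linear_fun_sum // sum_ffunE.
rewrite [RHS](reindex_onto enum_val enum_rank) /=; last by move=> a _; rewrite enum_rankK.
apply: eq_big => [i|i _]; first by rewrite enum_valK eqxx.
by rewrite !mxE ffunE.
Qed.

Lemma comm_mx_of L K : linear L -> linear K -> (forall f, L (K f) = K (L f)) ->
  comm_mx (mx_of L) (mx_of K).
Proof.
move=> linL linK LK; apply/row_matrixP => i.
by rewrite !row_mul !rowK !mul_mx_of // LK.
Qed.

(** Presenting the invariant subspace as the kernel of a commuting operator [P] makes it a [kermx],
    stable by commutation. Below, [P] is a projection, so its kernel is an orthogonal complement. *)
Lemma common_eigenfunction (T : Type) (U : T -> L2 A -> L2 A) (P : L2 A -> L2 A) f :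
  (forall t, linear (U t)) -> linear P ->
  (forall s t g, U s (U t g) = U t (U s g)) -> (forall t g, P (U t g) = U t (P g)) ->
  f != 0 -> P f = 0 ->
  exists v, [/\ v != 0, P v = 0 & forall t, exists a : C, U t v = a *: v].
Proof.
move=> linU linP comU comP f0 Pf.
have [|||v [v0 vP Uv]] :=
  @common_eigenvector_family C _ _ _ (fun t => mx_of (U t)) (kermx (mx_of P)).
- by move=> s t; apply: comm_mx_of.
- by move=> t; apply/comm_mx_stable_ker/comm_mx_of.
- apply: contraNneq f0 => V0; apply/eqP/(can_inj rV_ofK); rewrite rV_of0; apply/eqP.
  by rewrite -submx0 -V0 sub_kermx mul_mx_of // Pf rV_of0.
exists (ffun_of v); split.
- by apply: contraNneq v0 => v0; rewrite -[v]ffun_ofK v0 rV_of0.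
- apply: (can_inj rV_ofK); rewrite -mul_mx_of // ffun_ofK rV_of0.
  by apply/eqP; rewrite -sub_kermx.
- move=> t; have [a va] := Uv t; exists a; apply: (can_inj rV_ofK).
  rewrite -mul_mx_of // ffun_ofK va.
  by apply/rowP => i; rewrite !mxE !ffunE enum_valK.
Qed.

End MatrixOf.

(** * From a spectrum to the unitary group *)

Section Equivalence.
Variables (R : realType) (n : nat) (A : {fset 'rV[R]_n}).
Local Notation C := R[i]%C.

(** A finite list suffices: collect the frequencies used to expand each [chi a]. The projection
    fixes every [chi a], and these span. *)
Lemma spectral_orthonormal : spectral A ->
  exists2 E, orthonormal_exp A E & forall f : L2 A, multiplier E (fun=> 1) f = f.
Proof.
move=> [Lam [Lam0 [LamO LamS]]].
have /choice[s sP] : forall a : A, exists s : seq 'rV[R]_n,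
    {in s, forall l, Lam l} /\ exists c : _ -> C, chi a = \sum_(l <- s) c l *: e_res A l.
  by move=> a; have [s [c [sL ca]]] := LamS (chi a); exists s; split => //; exists c.
pose E := undup (flatten [seq s a | a <- enum {: A}]).
have EL l : l \in E -> Lam l.
  by rewrite mem_undup => /flatten_mapP[a _]; have [+ _] := sP a; apply.
have orthoE : orthonormal_exp A E.
  split=> [|l m lE mE]; first exact: undup_uniq.
  have [->|lm] := eqVneq l m; first by rewrite e_res_norm //; apply/Lam0/EL.
  by rewrite LamO //; exact: EL.
exists E => // f; have linP := multiplier_linear (A := A) E (fun=> 1).
rewrite [in RHS](L2_chi f) {1}(L2_chi f) linear_fun_sum //; apply: eq_bigr => a _.
have [sL [c ->]] := sP a; rewrite linear_fun_sum //; congr (_ *: _).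
apply: eq_big_seq => l ls; rewrite multiplier_e_res ?scale1r //.
by rewrite mem_undup; apply/flatten_mapP; exists a => //; rewrite mem_enum.
Qed.

Lemma continuous_multiplier E (f : L2 A) (b : A) :
  continuous (fun t => complex.Re (multiplier E (fun l => e_ l t) f b)) /\
  continuous (fun t => complex.Im (multiplier E (fun l => e_ l t) f b)).
Proof.
suff : forall F : 'rV[R]_n -> C, F = (fun t => multiplier E (fun l => e_ l t) f b) ->
    continuous (fun t => complex.Re (F t)) /\ continuous (fun t => complex.Im (F t)).
  exact.
elim: E => [F FE|l E /(_ _ erefl)[cRe cIm] F ->].
  have -> : F = fun=> 0 by rewrite FE; apply/funext => t; rewrite /multiplier big_nil ffunE.
  by split; exact: cst_continuous.
have [ceRe ceIm] := continuous_e l.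
pose w := l2dot f (e_res A l) * e_res A l b.
have E1 t : multiplier (l :: E) (fun l => e_ l t) f b =
    e_ l t * w + multiplier E (fun l => e_ l t) f b.
  by rewrite /multiplier big_cons ffunE; congr (_ + _); rewrite ffunE /w mulrA.
have cMr (h : 'rV[R]_n -> R) (c : R) : continuous h -> continuous (fun t => h t * c).
  by move=> ch t; exact: (continuous_comp (ch t) (@mulrr_continuous R c _)).
split.
- have -> : (fun t => complex.Re (multiplier (l :: E) (fun l => e_ l t) f b)) =
      (fun t => complex.Re (e_ l t) * complex.Re w - complex.Im (e_ l t) * complex.Im w +
         complex.Re (multiplier E (fun l => e_ l t) f b)).
    by apply/funext => t; rewrite E1; case: (e_ l t) (w) => [? ?] [? ?]; case: (multiplier _ _ _ _).
  by move=> t; exact: (cvgD (cvgB (cMr _ _ ceRe t) (cMr _ _ ceIm t)) (cRe t)).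
- have -> : (fun t => complex.Im (multiplier (l :: E) (fun l => e_ l t) f b)) =
      (fun t => complex.Re (e_ l t) * complex.Im w + complex.Im (e_ l t) * complex.Re w +
         complex.Im (multiplier E (fun l => e_ l t) f b)).
    by apply/funext => t; rewrite E1; case: (e_ l t) (w) => [? ?] [? ?]; case: (multiplier _ _ _ _).
  by move=> t; exact: (cvgD (cvgD (cMr _ _ ceRe t) (cMr _ _ ceIm t)) (cIm t)).
Qed.

Definition translation_group (U : 'rV[R]_n -> L2 A -> L2 A) :=
  (forall t, unitary (U t)) /\
  (forall (f : L2 A) (b : A),
     continuous (fun t : 'rV[R]_n => Re (U t f b)) /\
     continuous (fun t : 'rV[R]_n => Im (U t f b))) /\
  (forall t s, U (t + s) =1 U t \o U s) /\
  (forall a a' : A, U (val a - val a') (chi a) = chi a').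

Lemma spectral_translation_group : spectral A -> exists U, translation_group U.
Proof.
move=> /spectral_orthonormal[E orthoE idE].
pose U t := multiplier (A := A) E (fun l => e_ l t).
have UD t s : U (t + s) =1 U t \o U s.
  by move=> f; rewrite /U /= multiplierM //; apply: eq_multiplier => l; rewrite e_D.
have U0 f : U 0 f = f.
  rewrite -[RHS]idE; apply: eq_multiplier => l.
  by rewrite -(subrr 0) e_D e_N e_mul_conj.
exists U; split; last split; last split => //.
- move=> t; split; first exact: multiplier_linear.
  split=> [|f g]; last by rewrite l2dot_multiplier2 ?idE // => l; exact: e_mul_conj.
  by exists (U (- t)) => f; rewrite -[LHS]/((U _ \o U _) f) -UD ?subrr ?addNr U0.
- move=> f b; have [cRe cIm] := continuous_multiplier E f b.
  by split; [apply/continuous_Re|apply/continuous_Im].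
(* The coefficient of [chi a] at [l] is the conjugate of [e_ l (val a)] over the cardinality. The
   factor [e_ l (val a - val a')] turns [a] into [a'] there. *)
- move=> a a'; rewrite -(idE (chi a')); apply: eq_bigr => l _.
  have -> : e_ l (val a - val a') * l2dot (chi a) (e_res A l) = 1 * l2dot (chi a') (e_res A l).
    by rewrite !l2dot_chi_e_res mul1r mulrCA e_D e_N mulrAC e_mul_conj mul1r.
  by [].
Qed.

(** * From the unitary group to a spectrum *)

Section Converse.
Variables (U : 'rV[R]_n -> L2 A -> L2 A) (UP : translation_group U).

Let linU t : linear (U t). Proof. by have [/(_ t)[]] := UP. Qed.
Let Udot t f g : l2dot (U t f) (U t g) = l2dot f g.
Proof. by have [/(_ t)[_ []]] := UP. Qed.
Let UD t s f : U (t + s) f = U t (U s f).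
Proof. by have [_ [_ [-> _]]] := UP. Qed.
Let Uchi a a' : U (val a - val a') (chi a) = chi a'.
Proof. by have [_ [_ [_ ->]]] := UP. Qed.

(** The eigenvalue uses the same frequency on all of the row space, so distinct members have
    distinct characters and cannot merely coincide on [A]. *)
Definition joint_spectrum : set 'rV[R]_n :=
  [set l | e_res A l != 0 /\ forall t, U t (e_res A l) = e_ l t *: e_res A l]%classic.

(** Unitarity multiplies the inner product by [e_ l t * (e_ m t)^*] without changing it, and some
    [t] makes this factor differ from 1. *)
Lemma joint_spectrum_ortho l m : joint_spectrum l -> joint_spectrum m -> l != m ->
  l2dot (e_res A l) (e_res A m) = 0.
Proof.
move=> [_ Ul] [_ Um] /e_separates[t]; apply: contraNeq => lm0; apply/eqP.
by apply: (mulIf lm0); rewrite mul1r -[RHS](Udot t) Ul Um l2dotZl l2dotZr [RHS]mulrA.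
Qed.

Lemma eigenfunction_exp (v : L2 A) : v != 0 -> (forall t, exists a : C, U t v = a *: v) ->
  exists l (c : C), joint_spectrum l /\ e_res A l = c *: v.
Proof.
move=> /L2_neq0[b vb0] /choice[chr0 Uv].
(* Normalizing to [u b = 1] lets the eigenvalue be read off as [U t u b], whose continuity is part
   of [UP]; the chosen [chr0] carries no such information. *)
have [u uv] : exists u : L2 A, u = (v b)^-1 *: v by eexists.
have ub : u b = 1 by rewrite uv ffunE; exact: mulVf.
have u0 : u != 0 by apply: contra_eq_neq ub => ->; rewrite ffunE eq_sym oner_eq0.
have [chr chr_def] : exists chr : 'rV[R]_n -> C, chr = fun t => U t u b by eexists.
have Uu t : U t u = chr t *: u.
  have Utu : U t u = chr0 t *: u by rewrite uv linear_funZ // Uv !scalerA mulrC.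
  have -> : chr t = chr0 t by rewrite chr_def Utu ffunE ub; exact: mulr1.
  exact: Utu.
have [||||l chrE] := @continuous_character_rV _ _ chr.
- move=> s t; rewrite {1}chr_def UD Uu linear_funZ // Uu scalerA ffunE ub.
  exact: etrans (mulr1 _) (mulrC _ _).
- by move=> t; apply: (mulIf (l2dot_neq0 u0)); rewrite mul1r -[RHS](Udot t) Uu l2dotZl l2dotZr [RHS]mulrA.
- by rewrite chr_def; have [_ [/(_ u b)[/continuous_Re]]] := UP.
- by rewrite chr_def; have [_ [/(_ u b)[_ /continuous_Im]]] := UP.
have elu : e_res A l = e_ l (val b) *: u.
  apply/ffunP => a; rewrite !ffunE.
  (* As [U (val a - val b)] sends [chi a] to [chi b], this gives
     [u a = chr (val a - val b) * u b]. *)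
  have := Udot (val a - val b) u (chi a); rewrite Uchi Uu l2dotZl !l2dot_chi mulrCA.
  move=> /(mulfI _) => /(_ _)<-; last by rewrite invr_eq0 card_neq0.
  rewrite ub mulr1 chrE e_D e_N.
  by rewrite -[RHS]/(_ * _) mulrCA e_mul_conj mulr1.
exists l, (e_ l (val b) * (v b)^-1); split; last by rewrite elu uv scalerA.
split=> [|t]; first by rewrite elu scaler_eq0 negb_or e_neq0.
by rewrite elu linear_funZ // Uu chrE !scalerA mulrC.
Qed.

(** By unitarity, the coefficient of [U t f] at [l] is [e_ l t] times that of [f], which is also the
    eigenvalue of [U t] at [e_res A l]. *)
Lemma multiplier_commutes E t f : orthonormal_exp A E -> {in E, forall l, joint_spectrum l} ->
  multiplier E (fun=> 1) (U t f) = U t (multiplier E (fun=> 1) f).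
Proof.
move=> orthoE ES; rewrite linear_fun_sum //; apply: eq_big_seq => l /ES[_ Ul].
rewrite Ul scalerA !mul1r mulrC -(Udot t f) Ul l2dotZr mulrA e_mul_conj mul1r //.
Qed.

Lemma joint_spectrum_basis : orthogonal_basis_exp A joint_spectrum.
Proof.
pose good (E : seq 'rV[R]_n) := uniq E /\ {in E, forall l, joint_spectrum l}.
have good_ortho E : good E -> orthonormal_exp A E.
  move=> [uE ES]; split => // l m lE mE; have [<-|lm] := eqVneq l m.
    by rewrite e_res_norm //; case: (ES _ lE).
  by rewrite joint_spectrum_ortho //; exact: ES.
pose P k := `[< exists E, good E /\ size E = k >].
have exP : exists k, P k by exists 0%N; apply/asboolP; exists [::].
have ubP k : P k -> (k <= #|{: A}|)%N.
  by move=> /asboolP[E [/good_ortho /orthonormal_size + <-]].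
have [_ /asboolP[E [gE <-]] maxE] := ex_maxnP exP ubP.
have orthoE := good_ortho _ gE; have [uE ES] := gE.
split; first by move=> l [].
split=> [|f]; first exact: joint_spectrum_ortho.
(* The factor 1 makes this sum convertible to the projection of [f]. *)
exists E, (fun l => 1 * l2dot f (e_res A l)); split => //.
pose M := multiplier (A := A) E (fun=> 1).
apply/eqP; rewrite -[X in _ == X]/(M f) -subr_eq0; apply/negPn/negP => r0.
have linM : linear M by exact: multiplier_linear.
have Mr : M (f - M f) = 0.
  rewrite addrC -scaleN1r linM scaleN1r /M multiplierM //.
  by rewrite (@eq_multiplier _ _ _ _ _ (fun=> 1)) ?addNr // => l; rewrite mulr1.
have [||v [v0 Mv Uv]] := common_eigenfunction linU linM _ _ r0 Mr.
- by move=> s t g; rewrite -!UD addrC.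
- by move=> t g; exact: multiplier_commutes.
have [l [c [Sl lv]]] := eigenfunction_exp v0 Uv.
(* If [l] were in [E], the projection [M] would fix [e_res A l]. It also kills it, as a multiple of
   [v], contradicting that it is nonzero. *)
have lE : l \notin E.
  apply/negP => lE; have [/eqP] := Sl; case.
  by rewrite -[LHS]scale1r -(multiplier_e_res orthoE (fun=> 1) lE) lv -/M linear_funZ // Mv scaler0.
have /maxE : P (size E).+1.
  apply/asboolP; exists (l :: E); split => //; split; first by rewrite /= lE.
  by move=> m; rewrite inE => /predU1P[->|/ES].
by rewrite ltnn.
Qed.

End Converse.
End Equivalence.

Theorem theorem2p6 (R : realType) (n : nat) (A : {fset 'rV[R]_n}) :
  spectral A <->
  exists U : 'rV[R]_n -> L2 A -> L2 A,
    (forall t, unitary (U t)) /\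
    (* (strong) continuity of t |-> U(t) on the finite-dimensional space L^2(A) *)
    (forall (f : L2 A) (b : A),
       continuous (fun t : 'rV[R]_n => Re (U t f b)) /\
       continuous (fun t : 'rV[R]_n => Im (U t f b))) /\
    (forall t s, U (t + s) =1 U t \o U s) /\
    (forall a a' : A, U (val a - val a') (chi a) = chi a').
Proof.
split=> [|[U UP]]; first exact: spectral_translation_group.
by exists (joint_spectrum U); exact: joint_spectrum_basis.
Qed.
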